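(* Let $n\ge 2$, $0<\rho<1$, $1\le\tau\le n$, and let $\mathbf{M}\in\mathbb{R}^{n\times n}$ be the $\rho$-matrix, i.e. $\mathbf{M}_{ii}=1$ for all $i$ and $\mathbf{M}_{ij}=\rho$ for all $i\ne j$. Let $\mathbf{G}=\mathbf{M}$, let $\hat S$ be the $\tau$-nice sampling, and let $$\sigma_1=\lambda_{\min}\left(\mathbf{G}^{1/2}\,\mathbb{E}\left[(\mathbf{M}_{\hat S})^{-1}\right]\mathbf{G}^{1/2}\right),\qquad \theta=\lambda_{\max}\left(\mathbf{G}^{1/2}\,\mathbb{E}\left[(\mathbf{M}_{\hat S})^{-1}\right]\mathbf{G}^{1/2}\right).$$ Put $$A(\tau)=\frac{(\tau-2)\rho+1}{(1-\rho)((\tau-1)\rho+1)},\qquad B(\tau)=-\frac{\rho}{(1-\rho)((\tau-1)\rho+1)}.$$ Then $$\sigma_1=(1-\rho)\left(1-\frac{(\tau-1)B(\tau)}{(n-1)A(\tau)}\right)\frac{\tau A(\tau)}{n}$$ and $$\theta=(n\rho-\rho+1)\left(n\frac{(\tau-1)B(\tau)}{(n-1)A(\tau)}-\frac{(\tau-1)B(\tau)}{(n-1)A(\tau)}+1\right)\frac{\tau A(\tau)}{n}.$$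
   Context: The $\tau$-nice sampling picks a subset of $[n]=\{1,\dots,n\}$ of cardinality $\tau$ uniformly at random. For nonempty $S\subseteq[n]$, $\mathbf{I}_{:S}$ is the $n\times|S|$ matrix formed by the columns of the identity matrix indexed by $S$, $\mathbf{M}_{SS}=\mathbf{I}_{:S}^\top\mathbf{M}\mathbf{I}_{:S}$, and $(\mathbf{M}_S)^{-1}$ denotes the $n\times n$ matrix $\mathbf{I}_{:S}(\mathbf{M}_{SS})^{-1}\mathbf{I}_{:S}^\top$. The choice $\mathbf{G}=\mathbf{M}$ corresponds to the quadratic objective $f(x)=\frac12x^\top\mathbf{M}x$. *)

(* Defs.v *)
From HB Require Import structures.
From mathcomp Require Import all_boot all_order all_algebra.
From mathcomp Require Import boolp classical_sets reals.

Set Implicit Arguments.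
Unset Strict Implicit.
Unset Printing Implicit Defensive.

Import Order.TTheory GRing.Theory Num.Theory.
Local Open Scope classical_set_scope.
Local Open Scope ring_scope.

Section SymmetricMatrices.
Variables (R : realType) (n : nat).

Definition psd (H : 'M[R]_n) : Prop :=
  H^T = H /\ forall v : 'cV[R]_n, 0 <= (v^T *m H *m v) 0 0.

(* [xget 0 P] is an element of P if there is one, and 0 otherwise; a positive
   semidefinite matrix has exactly one positive semidefinite square root. *)
Definition sqrtmx (G : 'M[R]_n) : 'M[R]_n :=
  xget 0 [set H | psd H /\ H *m H = G].

(* [eigenvalue] is about row eigenvectors, which gives the same eigenvalues as
   column eigenvectors. Smallest and largest eigenvalues exist when X is
   symmetric and n > 0; the default value is 0. *)
Definition lambda_min (X : 'M[R]_n) : R :=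
  xget 0 [set a | eigenvalue X a /\ forall b, eigenvalue X b -> a <= b].

Definition lambda_max (X : 'M[R]_n) : R :=
  xget 0 [set a | eigenvalue X a /\ forall b, eigenvalue X b -> b <= a].

End SymmetricMatrices.

Section Sampling.
Variables (R : realType) (n : nat).

Definition id_cols (S : {set 'I_n}) : 'M[R]_(n, #|S|) :=
  \matrix_(i, j) (1%:M : 'M[R]_n) i (enum_val j).

Definition submx_SS (M : 'M[R]_n) (S : {set 'I_n}) : 'M[R]_#|S| :=
  (id_cols S)^T *m M *m id_cols S.

(* The inverse of the S x S submatrix of M, padded with zeros to size n. *)
Definition padded_inv (M : 'M[R]_n) (S : {set 'I_n}) : 'M[R]_n :=
  id_cols S *m invmx (submx_SS M S) *m (id_cols S)^T.

(* The law of a random subset of {0, ..., n-1} is given by its probability mass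
   function. *)
Definition tau_nice (tau : nat) (S : {set 'I_n}) : R :=
  if #|S| == tau then #|[set T : {set 'I_n} | #|T| == tau]%SET|%:R^-1 else 0.

Definition expect_mx (p : {set 'I_n} -> R) (X : {set 'I_n} -> 'M[R]_n) :
    'M[R]_n :=
  \sum_(S : {set 'I_n}) p S *: X S.

Definition rho_mx (rho : R) : 'M[R]_n :=
  \matrix_(i, j) (if i == j then 1 else rho).

End Sampling.

Arguments tau_nice {R} n tau S.
Arguments rho_mx {R} n rho.

(* Main.v *)
Require Import Defs.
From HB Require Import structures.
From mathcomp Require Import all_boot all_order all_algebra.
From mathcomp Require Import boolp classical_sets reals.
From mathcomp Require Import ring lra.

Import Order.TTheory GRing.Theory Num.Theory.
Local Open Scope ring_scope.

(** Every matrix in the problem belongs to the commutative algebra spanned by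
    the identity and the all-ones matrix J: it has the form a I + b J, with
    eigenvalue a + n b on the constant vectors and eigenvalue a on the vectors
    of sum zero.

    The matrix M is (1 - rho) I + rho J.  Its S x S block has the same form in
    dimension #|S|, hence so does the inverse of that block
    ([invmx_csym_mx]); its diagonal entries are A and the others B.  Since
    (i, j) lies in S x S with probability tau / n when i = j and
    tau (tau - 1) / (n (n - 1)) otherwise ([expect_padded_csym_mx]),
    averaging over S gives again a combination E of I and J.

    The square root H of M commutes with H H = M, hence with J because
    rho != 0, hence with E.  So H E H = E M ([sqrtmx_sandwich]), whose two
    eigenvalues are the two announced numbers.  The eigenvalue on constant
    vectors is the larger one because tau <= n. *)

(** The pattern known in statistics as compound symmetry. *)
Definition csym_mx (R : pzRingType) (n : nat) (a b : R) : 'M[R]_n :=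
  a%:M + const_mx b.
Arguments csym_mx {R n} a b.

(** * The algebra spanned by the identity and the all-ones matrix *)

Lemma csym_mxE (R : pzRingType) n (a b : R) (i j : 'I_n) :
  csym_mx a b i j = a *+ (i == j) + b.
Proof. by rewrite !mxE. Qed.

Lemma rho_mx_csym (R : realType) n (rho : R) :
  rho_mx n rho = csym_mx (1 - rho) rho.
Proof.
apply/matrixP=> i j; rewrite csym_mxE mxE.
by case: eqP => _; rewrite ?mulr1n ?subrK // mulr0n add0r.
Qed.

Lemma const_mulmx_const (R : pzRingType) m n p (a b : R) :
  (const_mx a : 'M_(m, n)) *m (const_mx b : 'M_(n, p))
  = const_mx (n%:R * (a * b)).
Proof.
apply/matrixP=> i j; rewrite !mxE.
under eq_bigr do rewrite !mxE.
by rewrite sumr_const card_ord mulr_natl.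
Qed.

Lemma mul_csym_mx (R : comPzRingType) n (a b c d : R) :
  (csym_mx a b : 'M_n) *m csym_mx c d
  = csym_mx (a * c) (a * d + b * c + n%:R * (b * d)).
Proof.
rewrite /csym_mx mulmxDl !mulmxDr -scalar_mxM [const_mx b *m _%:M]scalar_mxC.
rewrite !mul_scalar_mx const_mulmx_const.
by apply/matrixP=> i j; rewrite !mxE; ring.
Qed.

Lemma invmx_csym_mx (R : fieldType) n (a b : R) :
  a != 0 -> a + n%:R * b != 0 ->
  invmx (csym_mx a b : 'M_n) = csym_mx a^-1 (- b / (a * (a + n%:R * b))).
Proof.
move=> a0 ab0.
set Y := (X in _ = X).
have XY : (csym_mx a b : 'M_n) *m Y = 1%:M.
  rewrite mul_csym_mx divff //.
  rewrite (_ : a * _ + _ + _ = 0); last by field; rewrite a0 ab0.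
  by apply/matrixP=> i j; rewrite csym_mxE addr0 !mxE.
have [uX _] := mulmx1_unit XY.
by rewrite -[LHS]mulmx1 -XY mulmxA mulVmx // mul1mx.
Qed.

(** * Spectrum *)

Lemma mulmx_csymE (R : comPzRingType) n (a b : R) (v : 'rV_n) (j : 'I_n) :
  (v *m csym_mx a b) 0 j = a * v 0 j + b * \sum_i v 0 i.
Proof.
rewrite mulmxDr mul_mx_scalar !mxE; congr (_ + _).
rewrite mulr_sumr; apply: eq_bigr => i _; rewrite mxE; exact: mulrC.
Qed.

Lemma eigenvalue_csym_mx_sum0 (F : fieldType) n (a b : F) :
  (2 <= n)%N -> eigenvalue (csym_mx a b : 'M_n) a.
Proof.
case: n => [|[|n]] // _; apply/eigenvalueP.
have sum0 : \sum_i (delta_mx 0 0 - delta_mx 0 1 : 'rV[F]_n.+2) 0 i = 0.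
  rewrite 2!big_ord_recl !mxE /= big1 ?addr0;
    last by move=> i _; rewrite !mxE /= subrr.
  by ring.
exists (delta_mx 0 0 - delta_mx 0 1).
  by apply/rowP=> j; rewrite mulmx_csymE sum0 mulr0 addr0 !mxE.
apply/eqP => /rowP /(_ 0); rewrite !mxE /= subr0.
by apply/eqP; rewrite oner_eq0.
Qed.

Lemma eigenvalue_csym_mx_const (F : fieldType) n (a b : F) :
  (0 < n)%N -> eigenvalue (csym_mx a b : 'M_n) (a + n%:R * b).
Proof.
case: n => // n _; apply/eigenvalueP; exists (const_mx 1).
  apply/rowP=> j; rewrite mulmx_csymE.
  under eq_bigr do rewrite mxE.
  by rewrite sumr_const card_ord !mxE; ring.
apply/eqP => /rowP /(_ 0); rewrite !mxE.
by apply/eqP; rewrite oner_eq0.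
Qed.

(** Summing the coordinates of the eigenvector equation shows that the
    eigenvalue is a + n b unless the eigenvector has sum zero; in the latter
    case J kills it. *)
Lemma eigenvalue_csym_mx_inv (F : fieldType) n (a b c : F) :
  eigenvalue (csym_mx a b : 'M_n) c -> c = a \/ c = a + n%:R * b.
Proof.
move=> /eigenvalueP [v vc v0].
have vE j : a * v 0 j + b * (\sum_i v 0 i) = c * v 0 j.
  by rewrite -mulmx_csymE vc mxE.
have : \sum_j (a * v 0 j + b * (\sum_i v 0 i)) = \sum_j c * v 0 j.
  by apply: eq_bigr.
rewrite big_split /= -!mulr_sumr sumr_const card_ord.
move: vE; set s := \sum_i v 0 i => vE sE.
have [s0|s0] := eqVneq s 0.
  left; have /rV0Pn [j vj] := v0.
  by apply: (mulIf vj); rewrite -vE s0 mulr0 addr0.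
by right; apply: (mulIf s0); rewrite -sE; ring.
Qed.

Lemma lambda_minE {R : realType} {n} {X : 'M[R]_n} {a : R} :
  eigenvalue X a -> (forall b, eigenvalue X b -> a <= b) -> lambda_min X = a.
Proof.
move=> Xa Xmin; rewrite /lambda_min; case: xgetP => [y _ [Xy ymin]|none].
  by apply/le_anti; rewrite ymin //= Xmin.
by case: (none a).
Qed.

Lemma lambda_maxE {R : realType} {n} {X : 'M[R]_n} {a : R} :
  eigenvalue X a -> (forall b, eigenvalue X b -> b <= a) -> lambda_max X = a.
Proof.
move=> Xa Xmax; rewrite /lambda_max; case: xgetP => [y _ [Xy ymax]|none].
  by apply/le_anti; rewrite ymax //= Xmax.
by case: (none a).
Qed.

Lemma lambda_min_csym_mx (R : realType) n (a b : R) :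
  (2 <= n)%N -> 0 <= b -> lambda_min (csym_mx a b : 'M_n) = a.
Proof.
move=> n2 b0; apply: lambda_minE; first exact: eigenvalue_csym_mx_sum0.
by move=> c /eigenvalue_csym_mx_inv [] -> //; rewrite lerDl mulr_ge0.
Qed.

Lemma lambda_max_csym_mx (R : realType) n (a b : R) :
  (0 < n)%N -> 0 <= b -> lambda_max (csym_mx a b : 'M_n) = a + n%:R * b.
Proof.
move=> n0 b0; apply: lambda_maxE; first exact: eigenvalue_csym_mx_const.
by move=> c /eigenvalue_csym_mx_inv [] -> //; rewrite lerDl mulr_ge0.
Qed.

(** * Square roots *)

Lemma psd_csym_mx (R : realType) n (a b : R) :
  0 <= a -> 0 <= b -> psd (csym_mx a b : 'M_n).
Proof.
move=> a0 b0; split=> [|v].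
  by rewrite /csym_mx raddfD /= tr_scalar_mx trmx_const.
have -> : (v^T *m csym_mx a b *m v) 0 0
    = a * (\sum_i v i 0 ^+ 2) + b * (\sum_i v i 0) ^+ 2.
  rewrite mxE; set t := \sum_i v i 0.
  have vJ i : (v^T *m csym_mx a b) 0 i = a * v i 0 + b * t.
    rewrite mulmx_csymE mxE; congr (_ + _ * _).
    by apply: eq_bigr => j _; rewrite mxE.
  under eq_bigr do rewrite vJ mulrDl -mulrA -expr2.
  by rewrite big_split /= -!mulr_sumr -mulrA.
by rewrite addr_ge0 // mulr_ge0 ?sqr_ge0 // sumr_ge0 // => i _; rewrite sqr_ge0.
Qed.

Lemma sqrtmx_sqr {R : realType} {n} {G H : 'M[R]_n} :
  psd H -> H *m H = G -> sqrtmx G *m sqrtmx G = G.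
Proof.
move=> Hpsd HG; rewrite /sqrtmx; case: xgetP => [K _ [] //|none].
by case: (none H).
Qed.

Lemma sqrtmx_csym_mx_sqr (R : realType) n (a b : R) :
  (0 < n)%N -> 0 <= a -> 0 <= b ->
  sqrtmx (csym_mx a b : 'M_n) *m sqrtmx (csym_mx a b) = csym_mx a b.
Proof.
move=> n0 a0 b0.
have n0R : n%:R != 0 :> R by rewrite pnatr_eq0 -lt0n.
have ab0 : 0 <= a + n%:R * b by rewrite addr_ge0 ?mulr_ge0.
(* The root is determined by its eigenvalues, the square roots of a and of
   a + n b. *)
pose c := (Num.sqrt (a + n%:R * b) - Num.sqrt a) / n%:R.
have c0 : 0 <= c by rewrite divr_ge0 // subr_ge0 ler_wsqrtr // lerDl mulr_ge0.
apply: (sqrtmx_sqr (psd_csym_mx R n (Num.sqrt a) c (sqrtr_ge0 a) c0)).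
rewrite mul_csym_mx -expr2 sqr_sqrtr //; congr csym_mx.
have : (Num.sqrt a + n%:R * c) ^+ 2 = a + n%:R * b.
  by rewrite /c mulrCA divff // mulr1 addrC subrK sqr_sqrtr.
have := sqr_sqrtr a0; move: (Num.sqrt a) => s s2 eq2.
apply: (mulfI n0R).
by apply: (addrI a); rewrite -eq2 -[in LHS]s2; ring.
Qed.

(** A matrix always commutes with its square; here the square determines J,
    so the square root commutes with the whole span of I and J. *)
Lemma sqrtmx_sandwich (R : realType) n (a b c d : R) :
  (0 < n)%N -> 0 <= a -> 0 < b ->
  sqrtmx (csym_mx a b : 'M_n) *m csym_mx c d *m sqrtmx (csym_mx a b)
  = csym_mx c d *m csym_mx a b.
Proof.
move=> n0 a0 b0; have := sqrtmx_csym_mx_sqr R n a b n0 a0 (ltW b0).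
set H := sqrtmx _ => HH.
have HE : H *m csym_mx c d = csym_mx c d *m H.
  have -> : csym_mx c d = (c - d / b * a)%:M + (d / b) *: csym_mx a b :> 'M_n.
    apply/matrixP=> i j; rewrite !mxE.
    by case: (i == j); rewrite ?mulr1n ?mulr0n; field;
      exact: lt0r_neq0.
  rewrite mulmxDl mulmxDr scalar_mxC -scalemxAr -scalemxAl.
  by rewrite -HH mulmxA.
by rewrite HE -mulmxA HH.
Qed.

(** * Blocks and their average *)

Lemma submx_SSE (R : realType) n (S : {set 'I_n}) (M : 'M[R]_n) :
  submx_SS M S = \matrix_(i, j) M (enum_val i) (enum_val j).
Proof.
apply/matrixP=> i j; rewrite !mxE (bigD1 (enum_val j)) //= big1 ?addr0.
  rewrite !mxE eqxx mulr1 (bigD1 (enum_val i)) //= big1 ?addr0.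
    by rewrite !mxE eqxx mul1r.
  by move=> k kj; rewrite !mxE (negbTE kj) mul0r.
by move=> k kj; rewrite 2![X in _ * X]mxE (negbTE kj) mulr0.
Qed.

Lemma submx_SS_csym (R : realType) n (S : {set 'I_n}) (a b : R) :
  submx_SS (csym_mx a b) S = csym_mx a b.
Proof.
rewrite submx_SSE; apply/matrixP=> i j.
by rewrite mxE !csym_mxE (inj_eq enum_val_inj).
Qed.

Lemma sum_id_cols (R : realType) n (S : {set 'I_n}) (i : 'I_n) :
  \sum_k id_cols R S i k = (i \in S)%:R.
Proof.
under eq_bigr do rewrite !mxE.
have [iS|iS] := boolP (i \in S).
  rewrite (bigD1 (enum_rank_in iS i)) //= enum_rankK_in // eqxx big1 ?addr0 //.
  move=> k kr; case: eqP => // ik; move: kr.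
  by rewrite [X in enum_rank_in _ X]ik enum_valK_in eqxx.
rewrite big1 // => k _; case: eqP => // ik.
by move: iS; rewrite ik enum_valP.
Qed.

Lemma id_cols_mul_tr (R : realType) n (S : {set 'I_n}) (i j : 'I_n) :
  (id_cols R S *m (id_cols R S)^T) i j = (i \in S)%:R *+ (i == j).
Proof.
rewrite mxE; have [<-|ij] := eqVneq i j.
  rewrite mulr1n -sum_id_cols; apply: eq_bigr => k _.
  by rewrite !mxE; case: eqP; rewrite ?mulr1 ?mulr0.
rewrite mulr0n big1 // => k _; rewrite !mxE.
case: eqP => [<-|]; rewrite ?mul0r //.
by rewrite eq_sym (negbTE ij) mulr0.
Qed.

(** The indicators of i in S and of j in S are the row sums of the matrix of
    columns, which is what the all-ones block picks up. *)
Lemma pad_csym_mxE (R : realType) n (S : {set 'I_n}) (a b : R) (i j : 'I_n) :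
  (id_cols R S *m csym_mx a b *m (id_cols R S)^T) i j
  = ([set i; j] \subset S)%:R * csym_mx a b i j.
Proof.
rewrite csym_mxE mulmxDr mulmxDl mul_mx_scalar -scalemxAl mxE.
rewrite [X in X + _]mxE id_cols_mul_tr.
have -> : (id_cols R S *m const_mx b *m (id_cols R S)^T) i j
    = (i \in S)%:R * (j \in S)%:R * b.
  rewrite -!sum_id_cols mulrAC mulr_sumr mxE; apply: eq_bigr => k _.
  rewrite [_^T _ _]mxE; congr (_ * _).
  rewrite mxE mulr_suml.
  by apply: eq_bigr => l _; rewrite [const_mx _ _ _]mxE.
rewrite finset.subUset !finset.sub1set mulrDr -mulnb natrM; congr (_ + _).
have [<-|_] := eqVneq i j; last by rewrite !mulr0n !mulr0.
by case: (i \in S); rewrite !mulr1n ?mulr0n; ring.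
Qed.

(** The supersets of U of cardinal k are the complements of the subsets of the
    complement of U of cardinal #|T| - k. *)
Lemma card_supersets (T : finType) (U : {set T}) (k : nat) :
  (k <= #|T|)%N ->
  #|[set S : {set T} | U \subset S & #|S| == k]| = 'C(#|T| - #|U|, #|T| - k).
Proof.
move=> kT.
have -> : (#|T| - #|U|)%N = #|~: U| by rewrite [RHS]finset.cardsCs finset.setCK.
rewrite -cards_draws -(card_imset _ (@finset.setC_inj T)).
apply: eq_card => S; rewrite inE; apply/imsetP/andP => [[V]|[SU Sk]].
  rewrite inE => /andP [UV /eqP <-] ->.
  by rewrite finset.setCS UV finset.cardsCs finset.setCK.
exists (~: S); last by rewrite finset.setCK.
rewrite inE finset.subsetC SU /= finset.cardsCs finset.setCK (eqP Sk) subKn //.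
Qed.

Lemma expect_tau_nice_superset (R : realType) n tau (U : {set 'I_n}) :
  (tau <= n)%N ->
  \sum_(S : {set 'I_n}) tau_nice n tau S * (U \subset S)%:R
  = 'C(n - #|U|, n - tau)%:R / 'C(n, tau)%:R :> R.
Proof.
move=> taun.
have cardn : #|[set T : {set 'I_n} | #|T| == tau]| = 'C(n, tau).
  by rewrite card_draws card_ord.
have cardU := @card_supersets _ U tau; rewrite card_ord in cardU.
rewrite -cardU // -cardn -sum1_card natr_sum mulr_suml [RHS]big_mkcond /=.
apply: eq_bigr => S _; rewrite inE /tau_nice andbC.
by case: (_ == tau); case: (U \subset S); rewrite /= ?mulr1 ?mulr0 ?mul0r ?mul1r.
Qed.

(** Membership of i and j in S is computed by counting the supersets of the
    set of both, which is a singleton when i = j.  The two applications of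
    [mul_bin_down] remove i and j one after the other from the
    ground set. *)
Lemma expect_padded_csym_mx (R : realType) n tau (a b : R)
    (Y : {set 'I_n} -> 'M[R]_n) :
  (2 <= n)%N -> (1 <= tau <= n)%N ->
  (forall S : {set 'I_n}, #|S| = tau ->
     Y S = id_cols R S *m csym_mx a b *m (id_cols R S)^T) ->
  expect_mx (tau_nice n tau) Y
  = csym_mx (tau%:R / n%:R * (a + b)
             - tau%:R * (tau%:R - 1) / (n%:R * (n%:R - 1)) * b)
            (tau%:R * (tau%:R - 1) / (n%:R * (n%:R - 1)) * b).
Proof.
move=> n2 /andP [tau1 taun] YE.
have C0 : 'C(n, tau)%:R != 0 :> R by rewrite pnatr_eq0 -lt0n bin_gt0.
have n0 : n%:R != 0 :> R by rewrite pnatr_eq0 -lt0n ltnW.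
have n1E : n.-1%:R = n%:R - 1 :> R by rewrite -subn1 natrB // ltnW.
have n1 : n%:R - 1 != 0 :> R by rewrite -n1E pnatr_eq0 -lt0n -subn1 subn_gt0.
have bin1 : 'C(n.-1, n - tau)%:R = tau%:R / n%:R * 'C(n, tau)%:R :> R.
  apply: (mulfI n0); rewrite -natrM mul_bin_down subKn // bin_sub // natrM.
  by field.
have bin2 : 'C(n.-2, n - tau)%:R
    = (tau%:R - 1) / (n%:R - 1) * 'C(n.-1, n - tau)%:R :> R.
  apply: (mulfI n1); rewrite -n1E -natrM mul_bin_down n1E.
  have -> : (n.-1 - (n - tau) = tau - 1)%N by rewrite -subn1 subnAC subKn.
  by rewrite natrM natrB //; field.
have YijE i j : expect_mx (tau_nice n tau) Y i j
    = 'C(n - #|[set i; j]|, n - tau)%:R / 'C(n, tau)%:R * csym_mx a b i j.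
  rewrite -expect_tau_nice_superset // mulr_suml summxE.
  apply: eq_bigr => S _; rewrite mxE -mulrA.
  have [Stau|Stau] := eqVneq #|S| tau; first by rewrite YE // pad_csym_mxE.
  by rewrite /tau_nice (negbTE Stau) !mul0r.
apply/matrixP=> i j; rewrite YijE !csym_mxE cards2.
have [_|_] := eqVneq i j; rewrite /= ?mulr1n ?mulr0n ?add0r ?subrK.
  by rewrite subn1 bin1 mulfK.
by rewrite subn2 bin2 bin1; field; rewrite n0 C0 n1.
Qed.

(** * The extreme eigenvalues *)

Theorem proposition2 (R : realType) (n tau : nat) (rho : R)
    (hn : (2 <= n)%N) (hrho : 0 < rho < 1) (htau : (1 <= tau <= n)%N) :
  let M : 'M[R]_n := rho_mx n rho in
  let G : 'M[R]_n := M in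
  let X : 'M[R]_n :=
    sqrtmx G *m expect_mx (tau_nice n tau) (padded_inv M) *m sqrtmx G in
  let sigma1 : R := lambda_min X in
  let theta : R := lambda_max X in
  let A : R := ((tau%:R - 2) * rho + 1)
                 / ((1 - rho) * ((tau%:R - 1) * rho + 1)) in
  let B : R := - rho / ((1 - rho) * ((tau%:R - 1) * rho + 1)) in
  sigma1 = (1 - rho) * (1 - ((tau%:R - 1) * B) / ((n%:R - 1) * A))
             * (tau%:R * A / n%:R)
  /\
  theta = (n%:R * rho - rho + 1)
            * (n%:R * (((tau%:R - 1) * B) / ((n%:R - 1) * A))
               - ((tau%:R - 1) * B) / ((n%:R - 1) * A) + 1)
            * (tau%:R * A / n%:R).
Proof.
move=> M G X sigma1 theta A B.
have /andP [rho0 rho1] := hrho; have /andP [tau1 taun] := htau.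
have n0 : (0 < n)%N by apply: ltnW.
have tauR1 : 1 <= tau%:R :> R by rewrite (ler_nat _ 1).
have taunR : tau%:R <= n%:R :> R by rewrite ler_nat.
have nR2 : 2 <= n%:R :> R by rewrite (ler_nat _ 2).
have r1 : 1 - rho != 0 by rewrite subr_eq0 gt_eqF.
have d0 : 0 < (tau%:R - 1) * rho + 1 by nra.
have e0 : 0 < (tau%:R - 2) * rho + 1 by nra.
have nR0 : n%:R != 0 :> R by apply: lt0r_neq0; lra.
have n1R0 : n%:R - 1 != 0 :> R by apply: lt0r_neq0; lra.
have EE : expect_mx (tau_nice n tau) (padded_inv M)
  = csym_mx (tau%:R / n%:R * ((1 - rho)^-1 + B)
             - tau%:R * (tau%:R - 1) / (n%:R * (n%:R - 1)) * B)
            (tau%:R * (tau%:R - 1) / (n%:R * (n%:R - 1)) * B).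
  apply: expect_padded_csym_mx => // S Stau.
  have d' : 1 - rho + #|S|%:R * rho = (tau%:R - 1) * rho + 1 by rewrite Stau; ring.
  rewrite /padded_inv /M rho_mx_csym submx_SS_csym invmx_csym_mx // d' //.
  exact: lt0r_neq0.
have ABE : (1 - rho)^-1 + B = A by rewrite /A /B; field; rewrite r1 lt0r_neq0.
set l1 := (1 - rho) * _ * _; set l2 := (n%:R * rho - rho + 1) * _ * _.
have XE : X = csym_mx l1 ((l2 - l1) / n%:R).
  rewrite /X EE ABE /G /M rho_mx_csym sqrtmx_sandwich // ?mul_csym_mx; last by lra.
  by congr csym_mx; rewrite /l1 /l2 /A /B; field;
    rewrite ?r1 ?nR0 ?n1R0 ?(lt0r_neq0 d0) ?(lt0r_neq0 e0).
(* The gap between the eigenvalues has n - tau as a factor, and it vanishes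
   at tau = n, where E is the inverse of M. *)
have gap0 : 0 <= (l2 - l1) / n%:R.
  have -> : (l2 - l1) / n%:R = rho * tau%:R * (n%:R - tau%:R)
      / (n%:R * (n%:R - 1) * ((tau%:R - 1) * rho + 1)).
    by rewrite /l1 /l2 /A /B; field;
      rewrite ?r1 ?nR0 ?n1R0 ?(lt0r_neq0 d0) ?(lt0r_neq0 e0).
  apply: divr_ge0; first by rewrite !mulr_ge0 ?subr_ge0 // ltW.
  by rewrite !mulr_ge0 ?(ltW d0) //; lra.
rewrite /sigma1 /theta XE lambda_min_csym_mx // lambda_max_csym_mx //.
by split=> //; rewrite mulrCA divff // mulr1 addrC subrK.
Qed.
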